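(* Let $\mathsf{G}$ be a connected weighted graph on $n$ vertices with Laplacian $A$, and let $\mathsf{G}_D$, with Laplacian $A_D\in\mathbb{R}^{N\times N}$, be obtained by disaggregating the first $m$ vertices of $\mathsf{G}$ into $d_1,\dots,d_m$ vertices, where $N=n-m+\sum_{k=1}^m d_k$. Let $A$ have eigenvalues $\lambda_1(A)\le\cdots\le\lambda_n(A)$ and let $\widetilde{A}_D=D_s^{-1}A_DD_s^{-1}$ have eigenvalues $\lambda_1(\widetilde{A}_D)\le\cdots\le\lambda_N(\widetilde{A}_D)$, where $$D_s=\operatorname{diag}\big(d_1^{-1/2}I_{d_1\times d_1},\dots,d_m^{-1/2}I_{d_m\times d_m},I_{(n-m)\times(n-m)}\big).$$ Then for $i=1,\dots,n$, $$\lambda_i(\widetilde{A}_D)\le\lambda_i(A)\le\lambda_{N-n+i}(\widetilde{A}_D).$$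
   Context: All graphs are finite, simple, undirected, with positive edge weights $\omega_e$. The Laplacian $A$ of $\mathsf{G}=(V,E,\omega)$ is the symmetric matrix with $\langle A\bm{u},\bm{v}\rangle=\sum_{e=(i,j)\in E}\omega_e(u_i-u_j)(v_i-v_j)$. Disaggregating the vertices $1,\dots,m$ of $\mathsf{G}$ into $d_1,\dots,d_m$ vertices: vertex $k\le m$ is replaced by a set $V_a^k$ of $d_k$ new vertices, and the remaining $n-m$ vertices are kept, so the new graph $\mathsf{G}_D$ has $N=n-m+\sum_k d_k$ vertices. Each edge of $\mathsf{G}$ gives exactly one edge of $\mathsf{G}_D$ of the same weight, where any endpoint $k\le m$ is replaced by one (arbitrarily chosen) vertex of $V_a^k$; in addition an arbitrary connected graph with positive edge weights is placed on each $V_a^k$. The vertices of $\mathsf{G}_D$ are ordered as $V_a^1,\dots,V_a^m$ (consecutively), followed by the $n-m$ kept vertices. *)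

(* Defs.v *)
From HB Require Import structures.
From mathcomp Require Import all_boot all_order all_algebra.
From mathcomp Require Import complex.

Set Implicit Arguments.
Unset Strict Implicit.
Unset Printing Implicit Defensive.

Import Order.TTheory GRing.Theory Num.Theory.
Local Open Scope ring_scope.

(* Weights are only meaningful on edges: nothing below reads [weight x y]
   when [x] and [y] are not adjacent. *)
Record wgraph (R : numDomainType) (n : nat) := WGraph {
  edge : rel 'I_n;
  weight : 'I_n -> 'I_n -> R;
  edge_sym : symmetric edge;
  edge_irr : irreflexive edge;
  weight_sym : forall x y, weight x y = weight y x;
  weight_gt0 : forall x y, edge x y -> 0 < weight x y
}.

(* The graph induced on the vertex set S is connected. *)
Definition connected_on (R : numDomainType) n (G : wgraph R n) (S : {set 'I_n}) :=
  forall x y, x \in S -> y \in S ->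
    connect [rel a b | [&& a \in S, b \in S & edge G a b]] x y.

Definition connected_graph (R : numDomainType) n (G : wgraph R n) :=
  connected_on G [set: 'I_n].

(* The condition i < j makes every undirected edge count once. *)
Definition laplacian_form (R : numDomainType) n (G : wgraph R n)
    (u v : 'cV[R]_n) : R :=
  \sum_(i < n) \sum_(j < n | (i < j)%N && edge G i j)
    weight G i j * (u i 0 - u j 0) * (v i 0 - v j 0).

(* The matrix of [laplacian_form] in the standard basis; [laplacianP] shows that
   it is the symmetric matrix representing the form. *)
Definition laplacian (R : numDomainType) n (G : wgraph R n) : 'M[R]_n :=
  \matrix_(i, j) laplacian_form G (delta_mx i 0) (delta_mx j 0).

Lemma laplacian_sym (R : numDomainType) n (G : wgraph R n) :
  (laplacian G)^T = laplacian G.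
Proof.
apply/matrixP=> i j; rewrite !mxE.
by apply: eq_bigr => a _; apply: eq_bigr => b _; rewrite mulrAC.
Qed.

Lemma laplacianP (R : numDomainType) n (G : wgraph R n) (u v : 'cV[R]_n) :
  ((laplacian G *m u)^T *m v) 0 0 = laplacian_form G u v.
Proof.
have E (w : 'cV[R]_n) i : w i 0 = \sum_a w a 0 * (delta_mx a 0 : 'cV[R]_n) i 0.
  rewrite (bigD1 i) //= mxE !eqxx mulr1 big1 ?addr0 // => a ai.
  by rewrite mxE eq_sym (negPf ai) mulr0.
rewrite mxE; under eq_bigr => b _.
  rewrite !mxE big_distrl /=; under eq_bigr => a _.
    rewrite mxE /laplacian_form big_distrl big_distrl /=.
    under eq_bigr => i _ do rewrite big_distrl big_distrl /=.
    over.
  over.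
under eq_bigr => b _ do rewrite exchange_big /=.
rewrite exchange_big /=; apply: eq_bigr => i _.
under eq_bigr => b _ do rewrite exchange_big /=.
rewrite exchange_big /=; apply: eq_bigr => j _.
rewrite (E u i) (E u j) (E v i) (E v j) -!sumrB mulr_sumr.
apply: eq_bigr => b _; rewrite mulr_sumr mulr_suml; apply: eq_bigr => a _.
rewrite -!mulrBr -!mulrA; congr (_ * _).
by rewrite mulrC -!mulrA mulrCA.
Qed.

(* The eigenvalues in nondecreasing order, repeated according to (algebraic)
   multiplicity; comparing degrees, [size s = n]. *)
Definition spectrum (R : numDomainType) n (A : 'M[R]_n) (s : seq R) :=
  sorted <=%R s /\ char_poly A = \prod_(a <- s) ('X - a%:P).

Lemma spectrum_exists (R : rcfType) n (A : 'M[R]_n) :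
  A^T = A -> exists s, spectrum A s.
Proof.
move=> AT; pose B := map_mx (real_complex R) A.
have Bherm : B \is hermsymmx.
  apply: realsym_hermsym; last by apply/mxOverP => i j; rewrite mxE complex_real.
  by apply/is_hermitianmxP; rewrite expr0 scale1r map_mx_id // /B map_trmx AT.
have /hermitian_normalmx /orthomx_spectralP Beq := Bherm.
have /mxOverP Dreal := hermitian_spectral_diag_real Bherm.
set P := spectralmx B in Beq; set D := spectral_diag B in Beq Dreal.
pose s := [seq complex.Re (D 0 i) | i <- enum 'I_n].
exists (sort <=%R s); split; first exact/sort_sorted/le_total.
rewrite (perm_big s) ?perm_sort //=; apply: (map_poly_inj (real_complex R)).
rewrite map_char_poly -/B.
have -> : char_poly B = char_poly (diag_mx D).
  have Pu : P \in unitmx by exact: spectral_unit.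
  pose Q := map_mx polyC P; pose Q' := map_mx polyC (invmx P).
  have Q'Q : Q' *m Q = 1%:M by rewrite -map_mxM mulVmx // map_mx1.
  rewrite /char_poly; have -> : char_poly_mx B = Q' *m char_poly_mx (diag_mx D) *m Q.
    rewrite /char_poly_mx mulmxBr mulmxBl scalar_mxC -(mulmxA _ Q' Q) Q'Q mulmx1.
    by rewrite -!map_mxM -Beq.
  by rewrite !det_mulmx mulrAC -det_mulmx Q'Q det1 mul1r.
rewrite char_poly_trig ?diag_mx_is_trig // rmorph_prod /= big_map big_enum /=.
apply: eq_bigr => i _; rewrite rmorphB /= map_polyX map_polyC /= mxE eqxx mulr1n.
by rewrite RRe_real.
Qed.

(* The graph has vertices 0, .., m-1, to be disaggregated, and r kept vertices
   m, .., m+r-1.  The vertices of the disaggregated graph are numbered block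
   after block: [\sum_(k < m) d k] new vertices, followed by the r kept ones.
   [origin x] is the vertex of the original graph that x comes from. *)
Definition origin m r (d : 'I_m -> nat) (x : 'I_(\sum_(k < m) d k + r)) :
    'I_(m + r) :=
  match split x with
  | inl y => lshift r (tagnat.sig1 y)
  | inr z => rshift m z
  end.

Record disaggregation (R : numDomainType) m r (d : 'I_m -> nat)
    (G : wgraph R (m + r)) (GD : wgraph R (\sum_(k < m) d k + r)) : Prop :=
  Disaggregation {
  disagg_nonempty : forall k, (0 < d k)%N;
  disagg_lift : forall i j, edge G i j ->
    exists! p : 'I_(\sum_(k < m) d k + r) * 'I_(\sum_(k < m) d k + r),
      [/\ origin p.1 = i, origin p.2 = j & edge GD p.1 p.2];
  disagg_edge : forall x y, edge GD x y -> origin x != origin y ->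
    edge G (origin x) (origin y) /\
    weight GD x y = weight G (origin x) (origin y);
  disagg_connected : forall k : 'I_m,
    connected_on GD [set x | origin x == lshift r k]
}.

Definition scaling_mx (R : rcfType) m r (d : 'I_m -> nat) :
    'M[R]_(\sum_(k < m) d k + r) :=
  block_mx (\mxdiag_(k < m) ((Num.sqrt (d k)%:R)^-1%:M : 'M[R]_(d k))) 0 0 1%:M.

Definition scaled_laplacian (R : rcfType) m r (d : 'I_m -> nat)
    (GD : wgraph R (\sum_(k < m) d k + r)) : 'M[R]_(\sum_(k < m) d k + r) :=
  invmx (scaling_mx R r d) *m laplacian GD *m invmx (scaling_mx R r d).

(* Main.v *)
(* Let P be the 0/1 matrix with P i x = 1 when x comes from i. New edges inside a
   block do not see a vector that is constant on blocks, so A = P A_D P^T, and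
   with Q = P D_s this reads A = Q (D_s^-1 A_D D_s^-1) Q^T where Q Q^T = 1: A is a
   compression of the scaled Laplacian, and the theorem is Cauchy interlacing.
   Interlacing is proved by comparing the numbers of eigenvalues below a
   threshold, after diagonalizing unitarily over R[i]. *)
Require Import Defs.
From mathcomp Require Import all_boot all_order all_algebra.
From mathcomp Require Import complex zify.

Set Implicit Arguments.
Unset Strict Implicit.
Unset Printing Implicit Defensive.

Import Order.TTheory GRing.Theory Num.Theory.
Local Open Scope ring_scope.
Local Open Scope sesquilinear_scope.

(** * Eigenvalue counts for compressions of diagonal matrices *)

Lemma adjmxM (C : numClosedFieldType) n p q (A : 'M[C]_(n, p)) (B : 'M[C]_(p, q)) :
  (A *m B) ^t* = B ^t* *m A ^t*.
Proof. by rewrite trmx_mul map_mxM. Qed.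

Lemma diag_form (C : numClosedFieldType) n (a x : 'rV[C]_n) :
  (x *m diag_mx a *m x ^t*) 0 0 = \sum_i a 0 i * `|x 0 i| ^+ 2.
Proof.
rewrite mul_mx_diag mxE; apply: eq_bigr => i _.
by rewrite !mxE normCK mulrAC mulrC.
Qed.

Lemma unitarymx_normE (C : numClosedFieldType) n N (M : 'M[C]_(n, N))
    (x : 'rV[C]_n) :
  M \is unitarymx -> \sum_j `|(x *m M) 0 j| ^+ 2 = \sum_i `|x 0 i| ^+ 2.
Proof.
have E k (y : 'rV[C]_k) : \sum_i `|y 0 i| ^+ 2 = (y *m y ^t*) 0 0.
  by rewrite mxE; apply: eq_bigr => i _; rewrite !mxE normCK.
move=> /unitarymxP MM; rewrite !E adjmxM.
by rewrite mulmxA -(mulmxA x M) MM mulmx1.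
Qed.

(** The submatrix with rows in [P] and columns in [S] has more rows than columns, so its left kernel
    contains a nonzero row; extending that row by zero outside [P] gives [x]. *)
Lemma exists_sparse_row (F : fieldType) n N (M : 'M[F]_(n, N))
    (P : pred 'I_n) (S : pred 'I_N) :
  (#|S| < #|P|)%N ->
  exists x : 'rV[F]_n, [/\ x != 0, forall i, ~~ P i -> x 0 i = 0
    & forall j, S j -> (x *m M) 0 j = 0].
Proof.
move=> ltSP; pose K := mxsub (@enum_val _ P) (@enum_val _ S) M.
have : kermx K != 0.
  rewrite kermx_eq0 /row_free neq_ltn.
  by rewrite (leq_ltn_trans (rank_leq_col _) ltSP).
case/rowV0Pn => y /sub_kermxP yK y0.
(* Right multiplication by [E] is extension by zero. *)
pose E : 'M[F]_(#|P|, n) := \matrix_(k, i) (enum_val k == i)%:R.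
have EE i : (y *m E) 0 i = \sum_k y 0 k * (enum_val k == i)%:R.
  by rewrite mxE; apply: eq_bigr => l _; rewrite mxE.
have Eval k : (y *m E) 0 (enum_val k) = y 0 k.
  rewrite EE // (bigD1 k) //= eqxx mulr1 big1 ?addr0 // => l lk.
  by rewrite (inj_eq enum_val_inj) (negPf lk) mulr0.
exists (y *m E); split.
- apply: contra_neq y0 => yE0; apply/rowP => k.
  by rewrite -Eval yE0 !mxE.
- move=> i Pi; rewrite EE // big1 // => k _; case: eqP => [ki|];
    last by rewrite mulr0.
  by move: (enum_valP k); rewrite ki unfold_in (negPf Pi).
- move=> j Sj; have := congr1 (fun v : 'rV[F]__ => v 0 (enum_rank_in Sj j)) yK.
  rewrite [RHS]mxE => <-; rewrite -mulmxA [LHS]mxE [RHS]mxE.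
  apply: eq_bigr => k _; congr (_ * _).
  rewrite !mxE enum_rankK_in // (bigD1 (enum_val k)) //= mxE eqxx mul1r.
  by rewrite big1 ?addr0 // => i ik; rewrite mxE eq_sym (negPf ik) mul0r.
Qed.

(* Dimension count: otherwise some nonzero vector lies in the sum of the
   eigenlines of the compression with a i <= t, and is mapped by M into the sum
   of the eigenlines with b j > t. *)
Lemma card_compression_le (C : numClosedFieldType) n N (M : 'M[C]_(n, N))
    (a : 'rV[C]_n) (b : 'rV[C]_N) (t : C) :
  b \is a realmx -> t \is Num.real -> M \is unitarymx ->
  diag_mx a = M *m diag_mx b *m M ^t* ->
  (#|[pred i | (a 0 i <= t)%R]| <= #|[pred j | (b 0 j <= t)%R]|)%N.
Proof.
move=> /mxOverP br tr Mu aE; rewrite leqNgt; apply/negP.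
case/(exists_sparse_row M) => x [x0 xP xS].
have : (x *m diag_mx a *m x ^t*) 0 0 <= \sum_i t * `|x 0 i| ^+ 2.
  rewrite diag_form; apply: ler_sum => i _.
  have [ai|/xP->] := boolP (a 0 i <= t); last by rewrite normr0 expr0n !mulr0.
  by rewrite ler_wpM2r ?exprn_ge0.
(* The same value is the form of [diag_mx b] at [x *m M], a row with the norm of [x]. Its
   coordinates with [b 0 j <= t] vanish, so the value must strictly exceed [t] times the squared
   norm. *)
rewrite aE -mulr_sumr -(unitarymx_normE x Mu) !mulmxA -mulmxA.
rewrite -adjmxM diag_form mulr_sumr; apply/negP.
have lbt j : ~~ (b 0 j <= t) -> t < b 0 j by rewrite real_ltNge.
(* The order on [C] is partial: negating the inequality gives a strict one only because both sides
   are real. *)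
rewrite -real_ltNge; last 2 first.
- by apply: rpred_sum => j _; rewrite rpredM ?rpredX ?normr_real.
- by apply: rpred_sum => j _; rewrite rpredM ?rpredX ?normr_real.
have : x *m M != 0.
  apply: contra_neq x0 => xM0.
  by rewrite -[x]mulmx1 -(unitarymxP Mu) mulmxA xM0 mul0mx.
case/rV0Pn => j xMj; rewrite [ltLHS](bigD1 j) // [ltRHS](bigD1 j) //=.
apply: ltr_leD; last apply: ler_sum => k _.
  rewrite ltr_pM2r ?exprn_gt0 ?normr_gt0 // lbt //.
  by apply: contra xMj => /xS ->.
have [/xS->|/lbt/ltW bk] := boolP (b 0 k <= t).
  by rewrite normr0 expr0n !mulr0.
by rewrite ler_wpM2r ?exprn_ge0.
Qed.

(** * Diagonalization of real symmetric matrices over [R[i]] *)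

Lemma char_poly_conj (R : comUnitRingType) n (P A : 'M[R]_n) :
  P \in unitmx -> char_poly (invmx P *m A *m P) = char_poly A.
Proof.
move=> Pu; pose Q := map_mx polyC P; pose Q' := map_mx polyC (invmx P).
have Q'Q : Q' *m Q = 1%:M by rewrite -map_mxM mulVmx // map_mx1.
rewrite /char_poly.
have -> : char_poly_mx (invmx P *m A *m P) = Q' *m char_poly_mx A *m Q.
  rewrite /char_poly_mx mulmxBr mulmxBl scalar_mxC -(mulmxA _ Q' Q) Q'Q mulmx1.
  by rewrite -!map_mxM.
by rewrite !det_mulmx mulrAC -det_mulmx Q'Q det1 mul1r.
Qed.

(** A real symmetric matrix becomes Hermitian over [R[i]], so its diagonal form is real and comes
    from a row over [R]. Unique factorization of the characteristic polynomial identifies that row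
    with [s] up to order. *)
Lemma spectrum_unitary_diag (R : rcfType) n (A : 'M[R]_n) (s : seq R) :
  A^T = A -> spectrum A s ->
  exists U : 'M[R[i]]_n, exists a : 'rV[R]_n,
    [/\ U \is unitarymx,
        map_mx (real_complex R) A = U ^t* *m
          diag_mx (map_mx (real_complex R) a) *m U
      & perm_eq s [seq a 0 i | i : 'I_n]].
Proof.
move=> AT [_ As]; set f := real_complex R; set B := map_mx f A.
have Bherm : B \is hermsymmx.
  apply: realsym_hermsym; last by apply/mxOverP => i j; rewrite mxE complex_real.
  by apply/is_hermitianmxP; rewrite expr0 scale1r map_mx_id // /B map_trmx AT.
have /hermitian_normalmx /orthomx_spectralP Beq := Bherm.
have /mxOverP Dreal := hermitian_spectral_diag_real Bherm.
set P := spectralmx B in Beq; set D := spectral_diag B in Beq Dreal.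
have Pu : P \is unitarymx by exact: spectral_unitarymx.
have aE : map_mx f (map_mx (@complex.Re R) D) = D.
  by apply/rowP => i; rewrite !mxE /f RRe_real.
exists P, (map_mx (@complex.Re R) D); split=> //.
  by rewrite aE -invmx_unitary.
apply: prod_XsubC_eq; apply: (map_poly_inj f); rewrite -As map_char_poly -/B.
have -> : char_poly B = char_poly (diag_mx D).
  by rewrite Beq char_poly_conj ?spectral_unit.
rewrite char_poly_trig ?diag_mx_is_trig // rmorph_prod /= big_map big_enum /=.
apply: eq_bigr => i _; rewrite rmorphB /= map_polyX map_polyC /= !mxE eqxx mulr1n.
by rewrite /f RRe_real.
Qed.

(** * Cauchy interlacing *)

(** If [U] and [V] diagonalize [A] and [B], then [M = U Q V^*] has orthonormal rows and exhibits
    [diag_mx a] as a compression of [diag_mx b]. *)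
Lemma count_compression_le (R : rcfType) n N (Q : 'M[R]_(n, N)) (A : 'M[R]_n)
    (B : 'M[R]_N) (s t : seq R) (x : R) :
  Q *m Q^T = 1%:M -> A = Q *m B *m Q^T -> B^T = B ->
  spectrum A s -> spectrum B t ->
  (count (<= x) s <= count (<= x) t)%N /\ (count (>= x) s <= count (>= x) t)%N.
Proof.
move=> QQ AE BT As Bt; set f := real_complex R.
have AT : A^T = A by rewrite AE !trmx_mul trmxK BT mulmxA.
have [U [a [Uu UA /permP pa]]] := spectrum_unitary_diag AT As.
have [V [b [Vu VB /permP pb]]] := spectrum_unitary_diag BT Bt.
have countE k (c : 'rV[R]_k) (p : pred R) :
    count p [seq c 0 i | i : 'I_k] = #|[pred i | p (c 0 i)]|.
  by rewrite count_map -size_filter cardE enumT.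
have Qt : (map_mx f Q) ^t* = map_mx f Q^T.
  by apply/matrixP => i j; rewrite !mxE conj_Creal ?complex_real.
have Mu : U *m map_mx f Q *m V ^t* \is unitarymx.
  rewrite !mul_unitarymx ?trmxC_unitary //.
  by apply/unitarymxP; rewrite Qt -map_mxM QQ map_mx1.
have ME : diag_mx (map_mx f a) = U *m map_mx f Q *m V ^t* *m
    diag_mx (map_mx f b) *m (U *m map_mx f Q *m V ^t*) ^t*.
  rewrite !adjmxM trmxCK Qt.
  transitivity (U *m map_mx f A *m U ^t*).
    by rewrite UA !mulmxA (unitarymxP Uu) mul1mx mulmxtVK.
  by rewrite AE !map_mxM VB !mulmxA.
have fr k (c : 'rV[R]_k) : map_mx f c \is a realmx.
  by apply/mxOverP => i j; rewrite mxE complex_real.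
have fxr y : f y \is Num.real by rewrite complex_real.
have card_le k (c : 'rV[R]_k) y :
    #|[pred i | (map_mx f c 0 i <= f y)%R]| = #|[pred i | (c 0 i <= y)%R]|.
  by apply: eq_card => i; rewrite !inE mxE lecR.
rewrite !pa !pb !countE; split.
  have := card_compression_le (fr _ b) (fxr x) Mu ME.
  by rewrite !card_le.
(* The count from above is the count from below for [- a], [- b] and [- x]. *)
have ME' : diag_mx (map_mx f (- a)) = U *m map_mx f Q *m V ^t* *m
    diag_mx (map_mx f (- b)) *m (U *m map_mx f Q *m V ^t*) ^t*.
  have diagN k (D : 'rV[R[i]]_k) : diag_mx (- D) = - diag_mx D by exact: raddfN.
  by rewrite !map_mxN !diagN mulmxN mulNmx -ME.
have := card_compression_le (fr _ (- b)) (fxr (- x)) Mu ME'.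
have card_ge k (c : 'rV[R]_k) :
    #|[pred i | ((- c) 0 i <= - x)%R]| = #|[pred i | (x <= c 0 i)%R]|.
  by apply: eq_card => i; rewrite !inE mxE lerN2.
by rewrite !card_le !card_ge.
Qed.

Lemma cauchy_interlacing (R : rcfType) n N (Q : 'M[R]_(n, N)) (A : 'M[R]_n)
    (B : 'M[R]_N) (s t : seq R) (i : nat) :
  Q *m Q^T = 1%:M -> A = Q *m B *m Q^T -> B^T = B ->
  spectrum A s -> spectrum B t -> (i < n)%N ->
  t`_i <= s`_i /\ s`_i <= t`_(N - n + i).
Proof.
move=> QQ AE BT As Bt lt_in.
have size_spectrum k (C : 'M[R]_k) u : spectrum C u -> size u = k.
  move=> [_ Cu]; apply: succn_inj.
  by rewrite -(size_prod_XsubC u id) -Cu size_char_poly.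
have sn := size_spectrum _ _ _ As; have tN := size_spectrum _ _ _ Bt.
have lenN : (n <= N)%N := mulmx1_min QQ.
have [le_st ge_st] := count_compression_le s`_i QQ AE BT As Bt.
have [[s_sorted _] [t_sorted _]] := (As, Bt).
split.
  (* More than [i] entries of [s] are at most its entry of index [i], hence so are more than [i]
     entries of [t]. *)
  apply: (nth_count_le _ t_sorted); apply: leq_trans le_st; rewrite ltnNge.
  apply/negP => ge_i; suff: s`_i < s`_i by rewrite ltxx.
  by apply: (nth_count_gt _ s_sorted); rewrite ge_i sn.
have lt_i : (count (< (s`_i)%R)%R s <= i)%N.
  rewrite leqNgt; apply/negP => /(nth_count_lt 0 s_sorted).
  by rewrite ltxx.
(* At least [n - i] entries of [s], hence of [t], reach the threshold, so at most [N - n + i]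
   entries of [t] lie below it. [lenN] keeps the natural subtraction from truncating. *)
apply: (nth_count_ge _ t_sorted); move: lt_i ge_st.
rewrite !count_lt_ge tN sn.
move: (count _ s) (count _ t) => c c'; lia.
Qed.

(** * Fibres of [origin] and the scaling matrix *)

Lemma origin_lshift m r (d : 'I_m -> nat) (y : 'I_(\sum_(k < m) d k)) :
  origin (lshift r y) = lshift r (tagnat.sig1 y).
Proof. by rewrite /origin (unsplitK (inl _)). Qed.

Lemma origin_rshift m r (d : 'I_m -> nat) (z : 'I_r) :
  origin (d := d) (rshift _ z) = rshift m z.
Proof. by rewrite /origin (unsplitK (inr _)). Qed.

Lemma card_origin_lshift m r (d : 'I_m -> nat) (k : 'I_m) :
  #|[pred x | origin (d := d) x == lshift r k]| = d k.
Proof.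
pose g (j : 'I_(d k)) : 'I_(\sum_(k < m) d k + r) := lshift r (tagnat.Rank k j).
have g_inj : injective g.
  move=> i j /lshift_inj /eqP; rewrite -val_eqE tagnat.eq_Rank => /andP[_].
  by move/eqP/val_inj.
rewrite -[RHS](card_ord (d k)) -(card_codom g_inj); apply: eq_card => x.
rewrite inE; apply/idP/codomP => [|[j ->]].
  case: (split_ordP x) => [y ->|z ->].
    rewrite origin_lshift eq_lshift => /eqP yk; subst k.
    by exists (tagnat.sig2 y); rewrite /g tagnat.sig2K.
  by rewrite origin_rshift eq_rlshift.
by rewrite origin_lshift tagnat.Rank1K.
Qed.

Lemma card_origin_rshift m r (d : 'I_m -> nat) (z : 'I_r) :
  #|[pred x | origin (d := d) x == rshift m z]| = 1%N.
Proof.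
rewrite -(card1 (rshift (\sum_(k < m) d k)%N z)); apply: eq_card => x.
rewrite !inE; case: (split_ordP x) => [y ->|z' ->].
  by rewrite origin_lshift !eq_lrshift.
by rewrite origin_rshift !eq_rshift.
Qed.

(** A kept vertex has a fibre of size one, so one formula in terms of fibre sizes covers both
    diagonal blocks. *)
Lemma scaling_mxE (R : rcfType) m r (d : 'I_m -> nat) :
  scaling_mx R r d = diag_mx (\row_x
    (Num.sqrt (#|[pred y | origin (d := d) y == origin x]|)%:R)^-1).
Proof.
pose a k : 'rV[R]_(d k) := const_mx (Num.sqrt (d k)%:R)^-1.
rewrite /scaling_mx.
have -> : \mxdiag_(k < m) ((Num.sqrt (d k)%:R)^-1%:M : 'M[R]_(d k)) =
    diag_mx (\mxrow_k a k).
  by rewrite diag_mxrow; apply/eq_mxdiag => k; rewrite diag_const_mx.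
rewrite -diag_const_mx -diag_mx_row; congr diag_mx; apply/rowP => x.
rewrite [RHS]mxE; case: (split_ordP x) => x' ->.
- by rewrite row_mxEl origin_lshift card_origin_lshift !mxE.
- by rewrite row_mxEr origin_rshift card_origin_rshift !mxE sqrtr1 invr1.
Qed.

(** * The Laplacian form on vectors constant on blocks *)

(** Ordered pairs count each edge twice. They allow edges of the two graphs to be matched without
    following the condition [i < j] through [origin]. *)
Lemma sum_sym_lt (R : numDomainType) n (P : rel 'I_n) (F : 'I_n -> 'I_n -> R) :
  symmetric P -> irreflexive P -> (forall i j, F i j = F j i) ->
  \sum_(i < n) \sum_(j < n | P i j) F i j =
  (\sum_(i < n) \sum_(j < n | (i < j)%N && P i j) F i j) *+ 2.
Proof.
move=> Ps Pi Fs; rewrite mulr2n.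
rewrite [X in _ = _ + X](exchange_big_dep xpredT) //= -big_split /=.
apply: eq_bigr => i _; rewrite (bigID (fun j : 'I_n => (i < j)%N)) /=.
congr (_ + _); first by apply: eq_bigl => j; rewrite andbC.
apply: eq_big => [j|j _]; last exact: Fs.
rewrite Ps; case Pji: (P j i); rewrite ?andbF // andbT -leqNgt leq_eqVlt.
by case: eqP => // /val_inj e; rewrite e Pi in Pji.
Qed.

Lemma laplacian_form_prolong (R : numDomainType) m r (d : 'I_m -> nat)
    (G : wgraph R (m + r)) (GD : wgraph R (\sum_(k < m) d k + r))
    (u v : 'cV[R]_(m + r)) :
  disaggregation G GD ->
  laplacian_form GD (\col_x u (origin x) 0) (\col_x v (origin x) 0) =
  laplacian_form G u v.
Proof.
move=> [_ lift_ex edge_or _]; apply: (pmulrnI (n := 2)) => //.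
rewrite /laplacian_form -!sum_sym_lt; do ?[exact: edge_sym | exact: edge_irr
  | by move=> i j; rewrite weight_sym -!mulrA -!(opprB (_ i 0)) mulrNN].
rewrite !pair_big_dep /=.
pose o (p : 'I_(\sum_(k < m) d k + r) * 'I_(\sum_(k < m) d k + r)) :=
  (origin p.1, origin p.2).
(* Edges inside a block contribute zero; the others are grouped by the origins of their
   endpoints. *)
rewrite (bigID (fun p => origin p.1 == origin p.2)) /= big1 ?add0r; last first.
  by move=> p /andP[_ /eqP e]; rewrite !mxE e subrr mulr0 mul0r.
rewrite (partition_big o (fun q => edge G q.1 q.2)) /=; last first.
  by move=> p /andP[e ne]; case: (edge_or _ _ e ne).
apply: eq_bigr => -[i j] /= Gij.
have [[x y] [/= [xi yj exy] uniq_xy]] := lift_ex i j Gij.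
have ne : origin x != origin y.
  by apply: contraTneq Gij; rewrite -xi -yj => ->; rewrite edge_irr.
(* By uniqueness of the lift, each group consists of a single ordered pair. *)
rewrite (big_pred1 (x, y)) => [|[x' y'] /=].
  by rewrite !mxE xi yj (edge_or _ _ exy ne).2 xi yj.
rewrite /o /= !xpair_eqE; apply/idP/idP.
  move=> /andP[/andP[e _] /andP[/eqP xi' /eqP yj']].
  by rewrite eq_sym (eq_sym y') -xpair_eqE; apply/eqP/uniq_xy.
by case/andP => /eqP -> /eqP ->; rewrite exy ne xi yj !eqxx.
Qed.

(** [P^T] pulls a vector back along [origin], so this is the preceding identity of forms read on
    basis vectors. *)
Lemma laplacian_prolong (R : numDomainType) m r (d : 'I_m -> nat)
    (G : wgraph R (m + r)) (GD : wgraph R (\sum_(k < m) d k + r)) :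
  let P : 'M[R]_(m + r, \sum_(k < m) d k + r) :=
    \matrix_(i, x) (origin x == i)%:R in
  disaggregation G GD -> laplacian G = P *m laplacian GD *m P^T.
Proof.
move=> P dis; apply/matrixP => i j.
have PE k : P^T *m delta_mx k 0 =
    \col_x (delta_mx k 0 : 'cV[R]_(m + r)) (origin x) 0.
  by apply/colP => x; rewrite -colE !mxE andbT.
rewrite mxE -(laplacian_form_prolong _ _ dis) -!PE -laplacianP.
rewrite !trmx_mul trmx_delta laplacian_sym trmxK !mulmxA.
by rewrite -colE -!mulmxA -rowE !mxE.
Qed.

Theorem theorem9 (R : rcfType) (m r : nat) (d : 'I_m -> nat)
    (G : wgraph R (m + r)) (GD : wgraph R (\sum_(k < m) d k + r)) :
  connected_graph G ->
  disaggregation G GD ->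
  forall lam lamD : seq R,
  spectrum (laplacian G) lam ->
  spectrum (scaled_laplacian GD) lamD ->
  let n := (m + r)%N in
  let N := (\sum_(k < m) d k + r)%N in
  forall i : nat, (i < n)%N ->
    lamD`_i <= lam`_i /\ lam`_i <= lamD`_(N - n + i).
Proof.
move=> _ dis lam lamD lamP lamDP n N i lt_in.
pose c (x : 'I_N) := #|[pred y : 'I_N | origin (d := d) y == origin (d := d) x]|.
pose P : 'M[R]_(n, N) := \matrix_(i, x) (origin x == i)%:R.
set S := scaling_mx R r d.
have c_gt0 x : (0 < c x)%N by apply/card_gt0P; exists x; rewrite inE.
have sqrtc_neq0 x : Num.sqrt (c x)%:R != 0 :> R.
  by rewrite sqrtr_eq0 -ltNge ltr0n.
have SE : S = diag_mx (\row_x (Num.sqrt (c x)%:R)^-1) by exact: scaling_mxE.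
have Su : S \in unitmx.
  rewrite SE unitmxE det_diag unitfE; apply/prodf_neq0 => x _.
  by rewrite mxE invr_eq0.
have ST : S^T = S by rewrite SE tr_diag_mx.
(* Fibres are nonempty because every [d k] is positive; without this a diagonal entry of [Q Q^T]
   would be 0. *)
have origin_onto (k : 'I_n) : exists x, origin (d := d) x = k.
  case: (split_ordP k) => [k' ->|z ->].
    by exists (lshift r (tagnat.Rank k' (Ordinal (disagg_nonempty dis k'))));
      rewrite origin_lshift tagnat.Rank1K.
  by exists (rshift _ z); rewrite origin_rshift.
apply: (@cauchy_interlacing R n N (P *m S) _ _ _ _ i _ _ _ lamP lamDP) => //.
(* Rows of [P] have disjoint supports, so off-diagonal entries of [Q Q^T] vanish. A diagonal entry
   sums the inverse fibre size over the fibre, which gives 1. *)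
- rewrite trmx_mul ST mulmxA -(mulmxA P) SE mulmx_diag mul_mx_diag.
  apply/matrixP => k l; rewrite mxE.
  under eq_bigr => x _ do rewrite !mxE -invfM -expr2 sqr_sqrtr ?ler0n //.
  rewrite [RHS]mxE; have [<-|ne] := eqVneq k l; last first.
    rewrite big1 // => x _; case: eqP => [->|_]; last by rewrite !mul0r.
    by rewrite (negPf ne) mulr0.
  have [x0 x0k] := origin_onto k.
  rewrite (bigID (fun x => origin x == k)) /= [X in _ + X]big1 ?addr0; last first.
    by move=> x /negPf ->; rewrite mulr0.
  under eq_bigr => x /eqP xk do rewrite xk eqxx mul1r mulr1 /c xk.
  rewrite sumr_const -[X in X *+ _]mulr1 -mulrnAr mulVf //.
  by rewrite pnatr_eq0 -lt0n -x0k c_gt0.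
(* The factors [S] in [Q] and [Q^T] cancel the inverses in the scaled Laplacian. *)
- rewrite (laplacian_prolong dis) -/P /scaled_laplacian -/S trmx_mul ST !mulmxA.
  by rewrite mulmxKV // mulmxK.
- by rewrite /scaled_laplacian -/S !trmx_mul laplacian_sym trmx_inv ST mulmxA.
Qed.
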